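(* Let $n\ge 3$ be an integer and let $\mathcal{P}_n(\mathcal{I}_{1,n-1})\subset\mathbb{R}^n$ be the first pyramidal interval vector polytope, i.e. the convex hull of $e_1,\dots,e_n$, $\alpha_{1,n-1}=e_1+e_2+\dots+e_{n-1}$ and $\alpha_{2,n}=e_2+e_3+\dots+e_n$. Then its (normalized) volume is $$\operatorname{vol}(\mathcal{P}_n(\mathcal{I}_{1,n-1}))=2(n-2).$$
   Context: Here $e_i$ denotes the $i$-th standard unit vector of $\mathbb{R}^n$. $\operatorname{vol}$ denotes normalized volume, i.e. volume measured with respect to a unimodular simplex (a unimodular simplex has volume $1$); for an $n$-dimensional lattice polytope in $\mathbb{R}^n$ this is $n!$ times the Euclidean volume. *)

(* Defs.v *)
From mathcomp Require Import all_boot all_order all_algebra.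
From mathcomp Require Import all_classical all_reals all_analysis.

Set Implicit Arguments.
Unset Strict Implicit.
Unset Printing Implicit Defensive.

Import Order.TTheory GRing.Theory Num.Theory.

Local Open Scope classical_set_scope.
Local Open Scope ring_scope.

Section Definitions.
Context {R : realType}.

(* The n-fold product of the Lebesgue measure on the line, carried by the
   library's measurable type of n-tuples; dimension 0 is the unit mass. *)
Fixpoint lebesgue_tuple (n : nat) : set (n.-tuple R) -> \bar R :=
  match n with
  | 0 => \d_[tuple]
  | m.+1 => pushforward (@lebesgue_measure R \x @lebesgue_tuple m)%E
              (fun p : R * m.-tuple R => [tuple of p.1 :: p.2])
  end.

Definition euclidean_volume (n : nat) (A : set 'rV[R]_n) : \bar R :=
  lebesgue_tuple [set t : n.-tuple R | A (\row_(i < n) tnth t i)].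

(* The normalization for which a unimodular simplex of dimension n in R^n has
   volume 1; meant for full-dimensional lattice polytopes. *)
Definition normalized_volume (n : nat) (A : set 'rV[R]_n) : \bar R :=
  ((n`!%:R)%:E * euclidean_volume A)%E.

Definition convex_hull (n : nat) (A : set 'rV[R]_n) : set 'rV[R]_n :=
  smallest (@convex_set R 'rV[R]_n) A.

Definition unit_vector (n : nat) (k : 'I_n) : 'rV[R]_n := delta_mx 0 k.

(* e_i + ... + e_j with the indices i, j counted from 1, while 'I_n counts
   from 0. *)
Definition interval_vector (n i j : nat) : 'rV[R]_n :=
  \sum_(k < n | (i <= k.+1 <= j)%N) unit_vector k.

Definition first_pyramidal_vectors (n : nat) : set 'rV[R]_n :=
  [set unit_vector k | k in [set: 'I_n]] `|`
  [set interval_vector n 1 n.-1; interval_vector n 2 n].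

Definition first_pyramidal_polytope (n : nat) : set 'rV[R]_n :=
  convex_hull (@first_pyramidal_vectors n).

End Definitions.

Arguments first_pyramidal_polytope : clear implicits.

(* Main.v *)
(* With u := (x_1 + ... + x_n - 1) / (n - 2), the polytope is cut out by
   x_1 >= 0, x_n >= 0, 0 <= u <= x_1 + x_n and x_i >= u for 1 < i < n: it is an
   iterated pyramid with apexes e_2, ..., e_{n-1} over the parallelogram with
   diagonals {e_1, beta} and {e_n, alpha}, where alpha and beta are the two
   interval vectors, and u is the total weight of alpha and beta.  Replacing
   the coordinate x_1 by u divides volumes by n - 2, and subtracting u from
   x_2, ..., x_{n-1} then preserves them.  The image is the set of nonnegative
   (u, y_2, ..., y_n) with y_2 + ... + y_n <= s and
   u + y_2 + ... + y_{n-1} <= s, at s = 1.  Slicing along y_2 lowers the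
   dimension by one and replaces s by s - y_2, down to a square of side s for
   n = 2; by induction the volume is 2 s^n / n!. *)

Require Import Defs.
From HB Require Import structures.
From mathcomp Require Import all_boot all_order all_algebra.
From mathcomp Require Import all_classical all_reals all_analysis.
From mathcomp Require Import measurable_realfun ring lra.

Set Implicit Arguments.
Unset Strict Implicit.
Unset Printing Implicit Defensive.

Import Order.TTheory GRing.Theory Num.Theory.
Import numFieldNormedType.Exports.

Local Open Scope classical_set_scope.
Local Open Scope ring_scope.

(** * Lebesgue measure on tuples: measure structure and slicing formulas *)

Section LebesgueTuple.
Context {R : realType}.
Local Notation mu := (@lebesgue_measure R).

Definition tcons m (p : measurableTypeR R * m.-tuple R) : m.+1.-tuple R :=
  [tuple of p.1 :: p.2].

Lemma measurable_tcons m : measurable_fun setT (@tcons m).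
Proof. exact: (@measurable_cons _ _ _ R fst m snd). Qed.

Definition tuncons m (t : m.+1.-tuple R) : measurableTypeR R * m.-tuple R :=
  (thead t, [tuple of behead t]).

Lemma measurable_tuncons m : measurable_fun setT (@tuncons m).
Proof.
apply/measurable_fun_pairP; split.
  exact: (@measurable_tnth _ R m.+1 ord0).
exact: (@measurable_behead _ R m).
Qed.

Lemma tunconsK m : cancel (@tuncons m) (@tcons m).
Proof. by move=> t; rewrite [RHS]tuple_eta. Qed.

Lemma tconsK m : cancel (@tcons m) (@tuncons m).
Proof. by move=> [x t]; congr pair; exact: val_inj. Qed.

(** The recursion yields only a set function, while product measures behave well over sigma-finite
    factors. Measure and sigma-finiteness are therefore carried together through one induction, and
    the canonical instances are read off from it. *)
Lemma lebesgue_tuple_exists n :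
  exists nu : {sigma_finite_measure set (n.-tuple R) -> \bar R},
    @lebesgue_tuple R n = nu.
Proof.
elim: n => [|m [nu nuE]].
  by exists (\d_[tuple] : {sigma_finite_measure set (0.-tuple R) -> \bar R}).
have lE : @lebesgue_tuple R m.+1 = pushforward (mu \x nu)%E (@tcons m).
  by rewrite /= nuE.
have [rho rhoE] : exists rho : {measure set (m.+1.-tuple R) -> \bar R},
    pushforward (mu \x nu)%E (@tcons m) = rho.
  unshelve eexists.
    apply: (pushforward (mu \x nu)%E (@tcons m) : {measure set _ -> \bar R}).
    exact: measurable_tcons.
  by [].
rewrite lE rhoE.
have sf : sigma_finite setT rho.
  have /sigma_finiteP[F [TF ndF Foo]] := sigma_finiteT mu.
  have /sigma_finiteP[G [TG ndG Goo]] := sigma_finiteT nu.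
  (* Boxes of finite measure, seen as sets of tuples. Both exhausting sequences increase, so a point
     lies in the box indexed by the larger of its two indices. *)
  exists (fun k => @tuncons m @^-1` (F k `*` G k)).
    apply/esym; rewrite -preimage_bigcup -subTset => t _ /=.
    have [i _ Fi] : (\bigcup_i F i) (thead t) by rewrite -TF.
    have [j _ Gj] : (\bigcup_i G i) [tuple of behead t] by rewrite -TG.
    exists (maxn i j) => //=; split.
    - by move: (thead t) Fi; exact/subsetPset/ndF/leq_maxl.
    - by move: [tuple of behead t] Gj; exact/subsetPset/ndG/leq_maxr.
  move=> k; have [mF Fkoo] := Foo k; have [mG Gkoo] := Goo k; split.
    rewrite -[X in measurable X]setTI; apply: measurable_tuncons => //.
    exact: measurableX.
  rewrite -rhoE /pushforward -comp_preimage.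
  rewrite (_ : _ \o _ = id); last by apply/funext => p; exact: tconsK.
  by rewrite preimage_id product_measure1E// lte_mul_pinfty// ge0_fin_numE.
pose sfin := isSFinite.Build _ _ _ rho (sfinite_measure_sigma_finite sf).
pose sigfin := isSigmaFinite.Build _ _ _ rho sf.
pose rho' : {sigma_finite_measure set (m.+1.-tuple R) -> \bar R} :=
  HB.pack (Measure.sort rho) (Measure.class rho) sfin sigfin.
by exists rho'.
Qed.

Let lebesgue_tuple0 n : @lebesgue_tuple R n set0 = 0%E.
Proof. by have [nu ->] := lebesgue_tuple_exists n; rewrite measure0. Qed.

Let lebesgue_tuple_ge0 n A : (0 <= @lebesgue_tuple R n A)%E.
Proof. by have [nu ->] := lebesgue_tuple_exists n; exact: measure_ge0. Qed.

Let lebesgue_tuple_sigma_additive n :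
  semi_sigma_additive (@lebesgue_tuple R n).
Proof.
by have [nu ->] := lebesgue_tuple_exists n; exact: measure_semi_sigma_additive.
Qed.

HB.instance Definition _ n := isMeasure.Build _ _ _ (@lebesgue_tuple R n)
  (@lebesgue_tuple0 n) (@lebesgue_tuple_ge0 n)
  (@lebesgue_tuple_sigma_additive n).

Let lebesgue_tuple_sigma_finite n : sigma_finite setT (@lebesgue_tuple R n).
Proof.
by have [nu ->] := lebesgue_tuple_exists n; exact: sigma_finiteT.
Qed.

HB.instance Definition _ n := Measure_isSigmaFinite.Build _ _ _
  (@lebesgue_tuple R n) (@lebesgue_tuple_sigma_finite n).

(** Slicing with the head as outer variable, which is how the product measure is defined. *)
Lemma lebesgue_tupleS m (A : set (m.+1.-tuple R)) :
  lebesgue_tuple A =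
  (\int[mu]_x lebesgue_tuple [set t : m.-tuple R | A (tcons (x, t))])%E.
Proof.
rewrite /= /pushforward /product_measure1; apply: eq_integral => x _ /=.
by congr lebesgue_tuple; apply/seteqP; split => t; rewrite /xsection /= inE.
Qed.

Lemma measurable_preimage_tcons m (A : set (m.+1.-tuple R)) :
  measurable A -> measurable (@tcons m @^-1` A).
Proof.
by move=> mA; rewrite -[X in measurable X]setTI; exact: measurable_tcons.
Qed.

(** The opposite order of slicing: both iterated integrals give the product value on rectangles, so
    uniqueness of the product measure identifies them. *)
Lemma lebesgue_tupleSr m (A : set (m.+1.-tuple R)) : measurable A ->
  lebesgue_tuple A =
  (\int[@lebesgue_tuple R m]_t mu [set x | A (tcons (x, t))])%E.
Proof.
move=> /measurable_preimage_tcons mA.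
transitivity ((mu \x @lebesgue_tuple R m)%E (@tcons m @^-1` A)) => //.
transitivity ((mu \x^ @lebesgue_tuple R m)%E (@tcons m @^-1` A)).
  by apply: product_measure_unique => // B C mB mC; exact: product_measure2E.
rewrite /product_measure2; apply: eq_integral => t _ /=.
by congr (mu _); apply/seteqP; split => x; rewrite /ysection /= inE.
Qed.

Lemma ge0_integral_tupleS m (f : m.+1.-tuple R -> \bar R) :
  measurable_fun setT f -> (forall t, 0 <= f t)%E ->
  (\int[@lebesgue_tuple R m.+1]_t f t =
   \int[mu]_x \int[@lebesgue_tuple R m]_t f (tcons (x, t)))%E.
Proof.
move=> mf f0.
transitivity (\int[pushforward (mu \x @lebesgue_tuple R m) (@tcons m)]_t f t)%E.
  by [].
rewrite ge0_integral_pushforward//; last exact: measurable_tcons.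
rewrite preimage_setT fubini_tonelli1 => [//||x]; last exact: f0.
by apply: measurableT_comp => //; exact: measurable_tcons.
Qed.

Lemma integral_tuple0 (f : 0.-tuple R -> \bar R) :
  (\int[@lebesgue_tuple R 0]_t f t)%E = f [tuple].
Proof.
transitivity (\int[\d_([tuple] : 0.-tuple R)]_t (cst (f [tuple]) t))%E.
  by apply: eq_integral => t _ /=; rewrite (tuple0 t).
by rewrite integral_cst//= diracT mule1.
Qed.

End LebesgueTuple.

(* Otherwise unification unfolds [lebesgue_tuple m.+1] into a pushforward and
   loses the canonical measure structure. *)
Local Opaque lebesgue_tuple.

(** * Affine change of variable on the line *)

Section Affine.
Context {R : realType}.
Local Notation mu := (@lebesgue_measure R).

(** The right-hand side is a measure in [A] that gives each half-open interval its length, and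
    Lebesgue measure is the only such measure. *)
Lemma lebesgue_measure_affine (A : set (measurableTypeR R)) (a b : R) :
  0 < a -> measurable A ->
  mu A = (a%:E * mu [set x | A (a * x + b)%R])%E.
Proof.
move=> a0 mA.
pose f (x : measurableTypeR R) : measurableTypeR R := a * x + b.
have mf : measurable_fun setT f.
  apply: measurable_funD; last exact: measurable_cst.
  by apply: measurable_funM => //; exact: measurable_cst.
have [nu nuE] : exists nu : {measure set (measurableTypeR R) -> \bar R},
    pushforward mu f = nu.
  unshelve eexists.
    by apply: (pushforward mu f : {measure set _ -> \bar R}); exact: mf.
  by [].
pose rho : {measure set (measurableTypeR R) -> \bar R} :=
  mscale (NngNum (ltW a0)) nu.
transitivity (rho A); last by rewrite /rho /= /mscale/= -nuE.
apply: (@lebesgue_measure_unique R rho) => // _ [[l r]] _ <-.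
rewrite /rho /= /mscale /= -nuE /pushforward.
have -> : f @^-1` `]l, r] = `](l - b) / a, (r - b) / a]%classic.
  apply/seteqP; split => x /=; rewrite !in_itv/= ltr_pdivrMr// ler_pdivlMr//;
  by rewrite ltrBlDr lerBrDr mulrC.
rewrite !lebesgue_measure_itv/= !lte_fin ltr_pM2r ?invr_gt0// ltrD2r.
case: ifPn => lr; last by rewrite mule0.
rewrite -!EFinB -EFinM; congr EFin; field; exact: lt0r_neq0.
Qed.

End Affine.

(** * Translation invariance in every dimension *)

Section Translation.
Context {R : realType}.
Local Notation mu := (@lebesgue_measure R).

Definition tadd n (v t : n.-tuple R) : n.-tuple R :=
  [tuple tnth t i + tnth v i | i < n].

Lemma measurable_tadd n (v : n.-tuple R) : measurable_fun setT (tadd v).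
Proof.
apply/measurable_fun_tnthP => i.
rewrite (_ : _ \o _ = (fun t : n.-tuple R => tnth t i + tnth v i)).
  by apply: measurable_funD; [exact: measurable_tnth|exact: measurable_cst].
by apply/funext => t /=; rewrite tnth_mktuple.
Qed.

Lemma tadd_tcons m (v : m.+1.-tuple R) x (t : m.-tuple R) :
  tadd v (tcons (x, t)) =
  tcons (x + thead v, tadd [tuple of behead v] t).
Proof.
apply: eq_from_tnth => i; rewrite tnth_mktuple.
case: (unliftP ord0 i) => [j|] ->; last by rewrite !tnth0.
by rewrite !tnthS tnth_mktuple [v in tnth v (lift _ _)]tuple_eta tnthS.
Qed.

Lemma measurable_tcons_sectionl m (A : set (m.+1.-tuple R)) (t : m.-tuple R) :
  measurable A -> measurable [set x : measurableTypeR R | A (tcons (x, t))].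
Proof.
move=> /measurable_preimage_tcons /(measurable_ysection t).
by rewrite (_ : ysection _ _ = [set x | A (tcons (x, t))])//; apply/seteqP;
  split => x; rewrite /ysection /= inE.
Qed.

Lemma measurable_tcons_sectionr m (A : set (m.+1.-tuple R)) x :
  measurable A -> measurable [set t : m.-tuple R | A (tcons (x, t))].
Proof.
move=> /measurable_preimage_tcons /(measurable_xsection x).
by rewrite (_ : xsection _ _ = [set t | A (tcons (x, t))])//; apply/seteqP;
  split => t; rewrite /xsection /= inE.
Qed.

(** A translation moves the head and then the tail. Slicing with the tail fixed removes the shift of
    the head; slicing with the head fixed leaves a shift of the tail, covered by induction. *)
Lemma lebesgue_tuple_tadd n (v : n.-tuple R) (A : set (n.-tuple R)) :
  measurable A -> lebesgue_tuple [set t | A (tadd v t)] = lebesgue_tuple A.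
Proof.
elim: n v A => [v A _|m IH v A mA].
  by congr lebesgue_tuple; apply/seteqP; split => t /=; rewrite (tuple0 t)
    (tuple0 (tadd _ _)).
pose w : m.-tuple R := [tuple of behead v].
have mS : measurable [set t : m.+1.-tuple R | A (tadd v t)].
  by rewrite -[X in measurable X]setTI; exact: measurable_tadd.
(* The intermediate map: it translates the tail and keeps the head. *)
pose g (t : m.+1.-tuple R) : m.+1.-tuple R :=
  tcons (thead t, tadd w [tuple of behead t]).
have mg : measurable_fun setT g.
  have mw : measurable_fun [set: m.+1.-tuple R]
      (fun t : m.+1.-tuple R => tadd w [tuple of behead t]).
    apply: (measurableT_comp (measurable_tadd w)).
    exact: (@measurable_behead _ R m).
  exact: (measurable_cons (@measurable_tnth _ R m.+1 ord0) mw).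
have gE x t : g (tcons (x, t)) = tcons (x, tadd w t).
  by congr tcons; congr pair; congr tadd; exact: val_inj.
rewrite lebesgue_tupleSr//.
transitivity (lebesgue_tuple [set t | A (g t)]).
  rewrite [RHS]lebesgue_tupleSr; last first.
    by rewrite -[X in measurable X]setTI; exact: mg.
  apply: eq_integral => t _ /=.
  rewrite [RHS](@lebesgue_measure_affine _ _ 1 (thead v))//; last first.
    rewrite (_ : mkset _ = [set x | A (tcons (x, tadd w t))]).
      exact: measurable_tcons_sectionl.
    by apply/seteqP; split => x /=; rewrite gE.
  rewrite mul1e; congr (mu _); apply/seteqP; split => x /=;
    by rewrite tadd_tcons gE mul1r.
rewrite lebesgue_tupleS [RHS]lebesgue_tupleS; apply: eq_integral => x _.
rewrite (_ : mkset _ = [set t | A (tcons (x, tadd w t))]); last first.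
  by apply/seteqP; split => t /=; rewrite gE.
exact: (IH w _ (measurable_tcons_sectionr x mA)).
Qed.

End Translation.

(** * Integral of a power of [s - x] *)

Section PowerIntegral.
Context {R : realType}.
Local Notation mu := (@lebesgue_measure R).

Lemma integral_subX (s : R) p : 0 <= s ->
  (\int[mu]_(x in `[0%R, s]) ((s - x) ^+ p)%R%:E =
   (s ^+ p.+1 / p.+1%:R)%R%:E)%E.
Proof.
(* The fundamental theorem of calculus is applied on a nondegenerate interval, so [s = 0] is treated
   apart. *)
rewrite le_eqVlt => /predU1P[<-|s0].
  by rewrite set_itv1 integral_set1 expr0n mul0r.
pose F (x : R) : R := - ((s - x) ^+ p.+1 / p.+1%:R).
have dF (x : R) : is_derive x 1 F ((s - x) ^+ p).
  have -> : F = (- p.+1%:R^-1) \*: ((cst s - id) ^+ p.+1).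
    apply/funext => y; rewrite /F !fctE.
    by rewrite -[RHS]/(- p.+1%:R^-1 * (s - y) ^+ p.+1) mulNr mulrC.
  apply: is_derive_eq.
  rewrite !fctE sub0r -[LHS]/(- p.+1%:R^-1 * (p.+1%:R * (s - x) ^+ p * -1)).
  by rewrite mulrN1 mulrNN mulKf// pnatr_eq0.
have cF : continuous F.
  move=> x; apply/differentiable_continuous/derivable1_diffP.
  exact: @ex_derive _ _ _ _ _ _ _ (dF x).
rewrite (@continuous_FTC2 _ _ F)//.
- by rewrite -EFinB /F subrr subr0 expr0n mul0r oppr0 sub0r opprK.
- apply: continuous_subspaceT => x.
  by apply: (@continuous_comp _ _ _ (fun x => s - x) (fun x => x ^+ p));
    [apply: cvgB; [exact: cvg_cst|exact: cvg_id]|exact: exprn_continuous].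
- split => [x _||].
  + exact: @ex_derive _ _ _ _ _ _ _ (dF x).
  + exact/cvg_at_right_filter/cF.
  + exact/cvg_at_left_filter/cF.
- by move=> x _; rewrite derive1E; exact: @derive_val _ _ _ _ _ _ _ (dF x).
Qed.

End PowerIntegral.

(** * Volume of the normal form of the polytope *)

Section Prism.
Context {R : realType}.
Local Notation mu := (@lebesgue_measure R).

Lemma measurable_set_le d (T : measurableType d) (f g : T -> R) :
  measurable_fun setT f -> measurable_fun setT g ->
  measurable [set x | f x <= g x].
Proof.
move=> mf mg.
rewrite (_ : mkset _ = setT `&` (fun x => f x <= g x) @^-1` [set true]).
  exact: measurable_fun_ler.
by rewrite setTI; apply/seteqP; split.
Qed.

Lemma measurable_set_forall_le d (T : measurableType d) (I : finType)
    (f g : I -> T -> R) :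
  (forall i, measurable_fun setT (f i)) ->
  (forall i, measurable_fun setT (g i)) ->
  measurable [set x | forall i, f i x <= g i x].
Proof.
move=> mf mg.
rewrite (_ : mkset _ = \bigcap_(i in setT) [set x | f i x <= g i x]).
  by apply: fin_bigcap_measurable => // i _; exact: measurable_set_le.
by apply/seteqP; split => x fg i; [move=> _|]; exact: fg.
Qed.

Lemma sum_tcons m x (t : m.-tuple R) :
  \sum_i tnth (tcons (x, t)) i = x + \sum_i tnth t i.
Proof.
rewrite big_ord_recl tnth0; congr (_ + _).
by apply: eq_bigr => i _; rewrite tnthS.
Qed.

Lemma tnth_tcons_max m x (t : m.+1.-tuple R) :
  tnth (tcons (x, t)) ord_max = tnth t ord_max.
Proof.
have -> : ord_max = lift ord0 ord_max :> 'I_m.+2 by exact: val_inj.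
by rewrite tnthS.
Qed.

(** The coordinates are u, y_2, ..., y_n with n = k + 2: the head is u and the last entry is y_n.
    The bound [s] is a parameter so that slices stay in the family. *)
Definition prism k (s : R) : set (k.+2.-tuple R) :=
  [set t | [/\ forall i, 0 <= tnth t i,
     \sum_i tnth t i - tnth t ord0 <= s &
     \sum_i tnth t i - tnth t ord_max <= s]].
Arguments prism : clear implicits.

Lemma prism_tcons k s u (t : k.+1.-tuple R) :
  prism k s (tcons (u, t)) <->
  [/\ 0 <= u, forall i, 0 <= tnth t i, \sum_i tnth t i <= s &
      u + \sum_i tnth t i - tnth t ord_max <= s].
Proof.
rewrite /prism /= sum_tcons tnth_tcons_max tnth0 addrAC subrr add0r.
split=> [[t0 ? ?]|[u0 t0 ? ?]]; split => //.
- by have := t0 ord0; rewrite tnth0.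
- by move=> i; have := t0 (lift ord0 i); rewrite tnthS.
- by move=> i; case: (unliftP ord0 i) => [j|] ->; rewrite ?tnth0// tnthS.
Qed.

Lemma measurable_prism k s : measurable (prism k s).
Proof.
have mt (i : 'I_k.+2) : measurable_fun [set: k.+2.-tuple R]
  (fun t : k.+2.-tuple R => tnth t i) by exact: measurable_tnth.
have mS (i : 'I_k.+2) : measurable_fun [set: k.+2.-tuple R]
  (fun t : k.+2.-tuple R => \sum_j tnth t j - tnth t i).
  by apply: measurable_funB => //; exact: measurable_sum.
rewrite (_ : prism k s = [set t | forall i, 0 <= tnth t i] `&`
  [set t | \sum_i tnth t i - tnth t ord0 <= s] `&`
  [set t | \sum_i tnth t i - tnth t ord_max <= s]).
  apply: measurableI; first apply: measurableI.
  - exact: (@measurable_set_forall_le _ _ _ (fun _ => cst 0)).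
  - exact: measurable_set_le.
  - exact: measurable_set_le.
by apply/seteqP; split => t; [case|case=> -[]].
Qed.

Lemma measurable_fun_tcons_section m (A : set (m.+1.-tuple R)) :
  measurable A ->
  measurable_fun setT (fun t : m.-tuple R => mu [set x | A (tcons (x, t))]).
Proof.
move=> /measurable_preimage_tcons mA.
rewrite (_ : (fun t => _) = mu \o ysection (@tcons _ m @^-1` A)).
  exact: measurable_fun_ysection.
by apply/funext => t /=; congr (mu _); apply/seteqP; split => x;
  rewrite /ysection /= inE.
Qed.

(** In dimension 2 each of the two sums reduces to a single coordinate, so the set is a square of
    side [s]. *)
Lemma prism0_section s x :
  [set u | prism 0 s (tcons (u, tcons (x, [tuple])))] =
  if x \in `[0, s] then `[0, s]%classic else set0.
Proof.
apply/seteqP; split => u /=; rewrite in_itv/=.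
  move=> /prism_tcons[u0 /(_ ord0)].
  rewrite !big_ord_recl big_ord0 addr0 !tnth0.
  move=> x0 xs us; rewrite x0 xs/= in_itv/= u0/=; move: us.
  by rewrite (_ : ord_max = ord0) ?tnth0 ?addrK//; exact: val_inj.
case: ifPn => // /andP[x0 xs]; rewrite /= in_itv/= => /andP[u0 us].
apply/prism_tcons; rewrite !big_ord_recl big_ord0 addr0 !tnth0; split => //.
  by move=> i; rewrite (ord1 i) tnth0.
by rewrite (_ : ord_max = ord0) ?tnth0 ?addrK//; exact: val_inj.
Qed.

(** The second coordinate is neither the first nor the last, so it occurs in both sums and fixing it
    just lowers [s] by [x]. *)
Lemma prismS_section k s x (t : k.+1.-tuple R) :
  [set u | prism k.+1 s (tcons (u, tcons (x, t)))] =
  if 0 <= x then [set u | prism k (s - x) (tcons (u, t))] else set0.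
Proof.
apply/seteqP; split => u /=.
  move=> /prism_tcons[u0 xt0]; rewrite sum_tcons tnth_tcons_max => ts us.
  have := xt0 ord0; rewrite tnth0 => -> /=; apply/prism_tcons; split => //.
  - by move=> i; have := xt0 (lift ord0 i); rewrite tnthS.
  - by rewrite lerBrDl.
  - by lra.
case: ifPn => // x0 /prism_tcons[u0 t0 ts us].
apply/prism_tcons; rewrite sum_tcons tnth_tcons_max; split => //; [|lra..].
by move=> i; case: (unliftP ord0 i) => [j|] ->; rewrite ?tnth0// tnthS.
Qed.

(** Integrating u innermost makes y_2 the head of the remaining tuple, ready for slicing. All real
    [s] are allowed because the induction reaches [s - x], which may be negative; the set is then
    empty. *)
Lemma integral_prism_section k s :
  (\int[@lebesgue_tuple R k.+1]_t mu [set u | prism k s (tcons (u, t))] =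
   (if 0 <= s then 2 * s ^+ k.+2 / k.+2`!%:R else 0)%R%:E)%E.
Proof.
have mf j r := measurable_fun_tcons_section (@measurable_prism j r).
elim: k s => [|k IH] s; rewrite ge0_integral_tupleS//.
  transitivity (\int[mu]_(x in `[0%R, s]) (cst s%:E x))%E.
    rewrite [RHS]integral_mkcond; apply: eq_integral => x _.
    rewrite integral_tuple0 patchE prism0_section mem_setE.
    case: ifPn => [|_]; last by rewrite measure0.
    rewrite in_itv/= => /andP[x0 xs].
    rewrite lebesgue_measure_itv/= lte_fin sube0; case: ltP => // s0.
    by congr EFin; apply/le_anti; rewrite s0 (le_trans x0).
  rewrite integral_cst//= lebesgue_measure_itv/= lte_fin sube0.
  case: (ltgtP 0 s) => s0 //=.
  - by rewrite mulrAC mulfV ?mul1r ?pnatr_eq0.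
  - by rewrite mule0.
  - by rewrite mule0 -s0 expr0n mulr0 mul0r.
(* Only slices with [x] in [0, s] contribute: a negative [x] gives an empty section, and for [x > s]
   the induction hypothesis gives 0. *)
transitivity (\int[mu]_(x in `[0%R, s])
    (2 / k.+2`!%:R * (s - x) ^+ k.+2)%R%:E)%E.
  rewrite [RHS]integral_mkcond; apply: eq_integral => x _.
  rewrite patchE mem_setE in_itv/=.
  rewrite (eq_integral (fun t => mu (if 0 <= x
    then [set u | prism k (s - x) (tcons (u, t))] else set0))); last first.
    by move=> t _; rewrite prismS_section.
  case: (leP 0 x) => x0 /=; last by rewrite measure0 integral0.
  by rewrite IH subr_ge0; case: leP => //; rewrite mulrAC.
case: (leP 0 s) => s0; last first.
  by rewrite set_itv_ge ?integral_set0// bnd_simp -ltNge.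
under eq_integral => x _ do rewrite EFinM.
rewrite ge0_integralZl//; last 2 first.
- apply/measurable_funTS/measurable_EFinP/measurable_funX.
  by apply: measurable_funB => //; exact: measurable_cst.
- move=> x /=; rewrite in_itv/= => /andP[x0 xs].
  by rewrite lee_fin exprn_ge0// subr_ge0.
rewrite integral_subX// -EFinM; congr EFin.
by rewrite mulf_div -natrM mulnC -factS.
Qed.

Lemma lebesgue_tuple_prism k :
  lebesgue_tuple (prism k 1) = (2 / k.+2`!%:R)%:E.
Proof.
rewrite lebesgue_tupleSr; last exact: measurable_prism.
by rewrite integral_prism_section ler01 expr1n mulr1.
Qed.

End Prism.

(** * Volume under affine maps of the head and shears of the tail *)

Section HeadTail.
Context {R : realType}.

(** For each fixed tail the head undergoes an affine map of slope [a], whose shift may depend on the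
    tail; the one-dimensional scaling is then integrated over tails. *)
Lemma lebesgue_tuple_affine_head m (A B : set (m.+1.-tuple R)) (a : R)
    (b : m.-tuple R -> R) :
  0 < a -> measurable A -> measurable B ->
  (forall x t, A (tcons (x, t)) <-> B (tcons (a * x + b t, t))) ->
  lebesgue_tuple B = (a%:E * lebesgue_tuple A)%E.
Proof.
move=> a0 mA mB AB; rewrite !lebesgue_tupleSr//.
rewrite -ge0_integralZl//; last 2 first.
- exact: measurable_fun_tcons_section.
- by rewrite lee_fin ltW.
apply: eq_integral => t _.
rewrite (lebesgue_measure_affine (b t) a0 (measurable_tcons_sectionl t mB)).
by congr (_ * lebesgue_measure _)%E; apply/seteqP; split => x /AB.
Qed.

(** For each fixed head the two slices of tails differ by a translation. *)
Lemma lebesgue_tuple_shear_tail m (A B : set (m.+1.-tuple R))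
    (v : R -> m.-tuple R) :
  measurable B ->
  (forall x t, A (tcons (x, t)) <-> B (tcons (x, tadd (v x) t))) ->
  lebesgue_tuple A = lebesgue_tuple B.
Proof.
move=> mB AB; rewrite !lebesgue_tupleS; apply: eq_integral => x _.
rewrite -[RHS](lebesgue_tuple_tadd (v x) (measurable_tcons_sectionr x mB)).
by congr lebesgue_tuple; apply/seteqP; split => t /AB.
Qed.

End HeadTail.

(** * Transport of the volume from the normal form *)

Section PyramidVolume.
Context {R : realType}.

(** The quantity u of the overview, with n = m + 2. *)
Definition level m (t : m.+2.-tuple R) : R := (\sum_i tnth t i - 1) / m%:R.

(** The tail holds x_2, ..., x_n; its last entry x_n is the one left unshifted. *)
Definition lowering m (u : R) : m.+1.-tuple R :=
  [tuple - ((i != ord_max)%:R * u) | i < m.+1].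

Definition shear_lower m (t : m.+2.-tuple R) : m.+2.-tuple R :=
  tcons (thead t, tadd (lowering m (thead t)) [tuple of behead t]).

Definition to_level m (t : m.+2.-tuple R) : m.+2.-tuple R :=
  tcons (level t, [tuple of behead t]).

(** Defined as a preimage so that its volume follows from the two changes of variables; [pyramidP]
    recovers the inequalities. *)
Definition pyramid m : set (m.+2.-tuple R) :=
  [set t | prism 1 (shear_lower (to_level t))].
Arguments pyramid : clear implicits.

Lemma shear_lower_tcons m u (t : m.+1.-tuple R) :
  shear_lower (tcons (u, t)) = tcons (u, tadd (lowering m u) t).
Proof. by congr (tcons (_, tadd _ _)); exact: val_inj. Qed.

Lemma to_level_tcons m x (t : m.+1.-tuple R) :
  to_level (tcons (x, t)) = tcons (level (tcons (x, t)), t).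
Proof. by congr (tcons (_, _)); exact: val_inj. Qed.

Lemma measurable_shear_lower m : measurable_fun setT (@shear_lower m).
Proof.
apply: (measurable_cons (@measurable_tnth _ R m.+2 ord0)).
apply/measurable_fun_tnthP => i.
rewrite (_ : _ \o _ = fun t : m.+2.-tuple R =>
  tnth t (lift ord0 i) - (i != ord_max)%:R * tnth t ord0); last first.
  by apply/funext => t /=; rewrite !tnth_mktuple [t in RHS]tuple_eta tnthS.
apply: measurable_funB; first exact: measurable_tnth.
by apply: measurable_funM; [exact: measurable_cst|exact: measurable_tnth].
Qed.

Lemma measurable_to_level m : measurable_fun setT (@to_level m).
Proof.
have ml : measurable_fun setT (@level m).
  apply: measurable_funM; last exact: measurable_cst.
  apply: measurable_funB; last exact: measurable_cst.
  by apply: measurable_sum => i; exact: measurable_tnth.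
exact: (measurable_cons ml (@measurable_behead _ R m.+1)).
Qed.

Lemma lebesgue_tuple_pyramid m : (0 < m)%N ->
  lebesgue_tuple (pyramid m) = (m%:R * (2 / m.+2`!%:R))%:E.
Proof.
move=> m0; have m0R : 0 < m%:R :> R by rewrite ltr0n.
have mS : measurable (@shear_lower m @^-1` prism 1).
  rewrite -[X in measurable X]setTI; apply: measurable_shear_lower => //.
  exact: measurable_prism.
have mP : measurable (pyramid m).
  rewrite -[X in measurable X]setTI.
  exact: (@measurable_to_level m _ (@shear_lower m @^-1` prism 1)).
rewrite EFinM -lebesgue_tuple_prism.
transitivity (m%:R%:E * (m%:R^-1%:E * lebesgue_tuple (pyramid m)))%E.
  by rewrite muleA -EFinM mulfV ?mul1e// lt0r_neq0.
(* The shear preserves volume. For a fixed tail [t], the level is affine in the head [x] with slope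
   1/m and shift (sum of [t] - 1)/m. *)
congr (_ * _)%E; rewrite -(@lebesgue_tuple_shear_tail _ _
  (@shear_lower m @^-1` prism 1) _ (@lowering m) (measurable_prism _)).
  apply/esym/(@lebesgue_tuple_affine_head _ _ _ _ m%:R^-1
    (fun t => (\sum_i tnth t i - 1) / m%:R)) => //; first by rewrite invr_gt0.
  move=> x t; rewrite /pyramid /= to_level_tcons /level sum_tcons.
  by rewrite [m%:R^-1 * x]mulrC -mulrDl addrA.
by move=> x t; rewrite /= shear_lower_tcons.
Qed.

Lemma sum_tadd_lowering m u (t : m.+1.-tuple R) :
  \sum_i tnth (tadd (lowering m u) t) i = \sum_i tnth t i - m%:R * u.
Proof.
under eq_bigr do rewrite !tnth_mktuple.
rewrite big_split/= sumrN -mulr_suml; congr (_ - _ * _).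
rewrite big_ord_recr/= eqxx addr0 (eq_bigr (fun=> 1)); last first.
  by move=> i _; rewrite -val_eqE/= ltn_eqF.
by rewrite sumr_const card_ord.
Qed.

(** Since m u = x_1 + ... + x_n - 1, the lowered tail sums to 1 - x_1. The two sum constraints of
    the prism thus become x_1 >= 0 and u <= x_1 + x_n. *)
Lemma pyramidP m (t : m.+2.-tuple R) : (0 < m)%N ->
  pyramid m t <->
  [/\ 0 <= level t, level t <= tnth t ord0 + tnth t ord_max,
      0 <= tnth t ord0 &
      forall i, i != ord0 -> (i != ord_max)%:R * level t <= tnth t i].
Proof.
move=> m0; have [p tp] : exists p, t = tcons p.
  by exists (tuncons t); rewrite tunconsK.
rewrite {t}tp; case: p => x t.
rewrite /pyramid /= to_level_tcons shear_lower_tcons.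
(* This linear relation is all that is kept of the level, which lets [lra] conclude. *)
have : m%:R * level (tcons (x, t)) = x + \sum_i tnth t i - 1.
  by rewrite /level sum_tcons mulrC divfK// pnatr_eq0 -lt0n.
move: (level _) => u mu.
rewrite tnth0 tnth_tcons_max; split.
  move=> /prism_tcons[u0 t0]; rewrite sum_tadd_lowering mu !tnth_mktuple eqxx.
  rewrite mul0r subr0 => x0 ux; split => //=; [lra..|] => i.
  case: (unliftP ord0 i) => [j|] ->; last by rewrite eqxx.
  rewrite tnthS => _; have := t0 j; rewrite !tnth_mktuple subr_ge0.
  by rewrite (_ : (lift ord0 j != ord_max) = (j != ord_max)).
move=> [u0 ux x0 tu]; apply/prism_tcons; rewrite sum_tadd_lowering mu.
rewrite !tnth_mktuple eqxx mul0r subr0; move: ux x0 => /= ux x0.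
split => //; [|lra..] => i.
rewrite !tnth_mktuple subr_ge0; have := tu (lift ord0 i).
by rewrite tnthS; exact.
Qed.

End PyramidVolume.

(** * Finite convex combinations in a convex set *)

Section ConvexSum.
Context {R : realType} {V : lmodType R}.

(* The statement is homogeneous in the weights so that it goes through by
   adding one term at a time: [y] lies in the cone over [B] at height [w]. *)
Let cone (B : set V) (w : R) (y : V) := 0 <= w /\ exists2 z, B z & y = w *: z.

Let cone_add (B : set V) w1 y1 w2 y2 :
  @convex_set R V B -> cone B w1 y1 -> cone B w2 y2 ->
  cone B (w1 + w2) (y1 + y2).
Proof.
move=> cB [w1_ge0 [z1 Bz1 ->]] [w2_ge0 [z2 Bz2 ->]].
split; first exact: addr_ge0.
(* At total height 0 both weights vanish and any point of [B] serves; otherwise the weights are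
   normalized by their sum. *)
have [w0|w_neq0] := eqVneq (w1 + w2) 0.
  have [/eqP -> /eqP ->] : (w1 == 0) /\ (w2 == 0).
    by apply/andP; rewrite -paddr_eq0 ?w0.
  by exists z1 => //; rewrite !scale0r !addr0 scale0r.
have w_gt0 : 0 < w1 + w2 by rewrite lt_neqAle eq_sym w_neq0 addr_ge0.
have l01 : Itv.spec (@Itv.num_sem R) (Itv.Real `[0%Z, 1%Z]) (w1 / (w1 + w2)).
  by rewrite /= /Itv.num_sem/= in_itv/= num_real divr_ge0 ?addr_ge0//
    ler_pdivrMr// mul1r lerDl.
pose l : {i01 R} := Itv.mk l01.
exists ((w1 / (w1 + w2)) *: z1 + (1 - w1 / (w1 + w2)) *: z2).
  by have := cB z1 z2 l; rewrite !inE; exact.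
rewrite scalerDr !scalerA mulrBr mulr1 mulrCA mulfV// mulr1.
by rewrite addrAC subrr add0r.
Qed.

Lemma convex_set_sum (B : set V) (I : finType) (c : I -> R) (z : I -> V) :
  @convex_set R V B -> (forall i, 0 <= c i) -> \sum_i c i = 1 ->
  (forall i, B (z i)) -> B (\sum_i c i *: z i).
Proof.
move=> cB c_ge0 c1 Bz.
(* The empty sum needs some point of [B]; an index exists because the weights sum to 1. *)
have [i0 _|I0] := pickP (@predT I); last first.
  by move: c1; rewrite big_pred0// => /eqP; rewrite eq_sym oner_eq0.
have : cone B (\sum_i c i) (\sum_i c i *: z i).
  elim/big_ind2 : _ => [|w1 y1 w2 y2|i _].
  - by split => //; exists (z i0) => //; rewrite scale0r.
  - exact: cone_add.
  - by split => //; exists (z i).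
by rewrite c1 => -[_ [y By ->]]; rewrite scale1r.
Qed.

End ConvexSum.

(** * Description of the polytope by inequalities *)

Section IntervalVector.
Context {R : realType}.

Lemma interval_vectorE n i j (k : 'I_n) :
  @interval_vector R n i j 0 k = ((i <= k.+1 <= j)%N)%:R.
Proof.
rewrite /interval_vector summxE big_mkcond (bigD1 k)//= big1 ?addr0.
  by rewrite mxE !eqxx; case: ifP.
by move=> l lk; rewrite mxE eqxx /= eq_sym (negPf lk); case: ifP.
Qed.

End IntervalVector.

(** The counterpart of [level] for row vectors. *)
Definition height {R : realType} m (x : 'rV[R]_m.+2) : R :=
  (\sum_i x 0 i - 1) / m%:R.

Section PyramidHull.
Local Open Scope convex_scope.
Context {R : realType}.
Variable m : nat.
Hypothesis m0 : (0 < m)%N.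
Implicit Types x : 'rV[R]_m.+2.

Let ineqs := [set x : 'rV[R]_m.+2 | [/\ 0 <= height x,
  height x <= x 0 ord0 + x 0 ord_max,
  0 <= x 0 ord0 &
  forall i, i != ord0 -> (i != ord_max)%:R * height x <= x 0 i]].

Let convex_ineqs : @convex_set R 'rV[R]_m.+2 ineqs.
Proof.
move=> x y l; rewrite !inE => -[hx hx0 x0 xi] [hy hy0 y0 yi].
have l0 : 0 <= l%:num by [].
have l1 : 0 <= 1 - l%:num by rewrite subr_ge0.
have E : (x : convex_lmodType 'rV[R]_m.+2) <| l |> y =
  l%:num *: x + (1 - l%:num) *: y by [].
(* The height is an affine function, so each inequality passes to convex combinations. *)
have hE : height (l%:num *: x + (1 - l%:num) *: y) =
    l%:num * height x + (1 - l%:num) * height y.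
  rewrite /height (eq_bigr (fun i => l%:num * x 0 i + (1 - l%:num) * y 0 i)).
    by rewrite big_split/= -!mulr_sumr; ring.
  by move=> i _; rewrite !mxE.
rewrite E /ineqs /= hE !mxE; move: l%:num l0 l1 {hE E} => k k0 k1.
split.
- by rewrite addr_ge0// mulr_ge0.
- have := ler_wpM2l k0 hx0; have := ler_wpM2l k1 hy0; lra.
- by rewrite addr_ge0// mulr_ge0.
- move=> i i0; rewrite !mxE.
  have := ler_wpM2l k0 (xi i i0); have := ler_wpM2l k1 (yi i i0); lra.
Qed.

Let unit_ineqs k : ineqs (unit_vector k).
Proof.
have uE i : unit_vector k 0 i = (i == k)%:R :> R by rewrite mxE eqxx.
have h0 : height (unit_vector k) = 0 :> R.
  rewrite /height (bigD1 k)//= big1 => [|i /negPf ik]; last by rewrite uE ik.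
  by rewrite uE eqxx addr0 subrr mul0r.
by rewrite /ineqs /= h0 !uE; split => // i _; rewrite mulr0 uE.
Qed.

Let alphaE i : @interval_vector R m.+2 1 m.+1 0 i = (i != ord_max)%:R.
Proof.
rewrite interval_vectorE -val_eqE /= ltn_neqAle.
by rewrite (ltn_ord i : (i <= m.+1)%N) andbT.
Qed.

Let betaE i : @interval_vector R m.+2 2 m.+2 0 i = (i != ord0)%:R.
Proof.
by rewrite interval_vectorE ltn_ord andbT -val_eqE /= ltnS lt0n.
Qed.

Let sum_neq (k : 'I_m.+2) : \sum_i (i != k)%:R = m.+1%:R :> R.
Proof.
rewrite (bigD1 k)//= eqxx add0r (eq_bigr (fun=> 1)) => [|i ->//].
by rewrite sumr_const cardC1 card_ord.
Qed.

Let height_interval k x : (forall i, x 0 i = (i != k)%:R) -> height x = 1.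
Proof.
move=> xE; rewrite /height (eq_bigr (fun i => (i != k)%:R)) => [|i _//].
by rewrite sum_neq -natr1 addrK divff// pnatr_eq0 -lt0n.
Qed.

Let vectors_ineqs : @first_pyramidal_vectors R m.+2 `<=` ineqs.
Proof.
move=> _ [[k _ <-]|[->|->]]; first exact: unit_ineqs.
- rewrite /ineqs /= (height_interval alphaE) !alphaE eqxx addr0.
  by split => // i _; rewrite alphaE mulr1.
- rewrite /ineqs /= (height_interval betaE) !betaE eqxx add0r.
  by split => // i i0; rewrite betaE i0 mulr1; case: (_ != _).
Qed.

(* Since alpha + e_n = beta + e_1, the weights r of alpha and s of beta may be
   any splitting of the height with 0 <= r <= x_1 and 0 <= s <= x_n. *)
Let ineqs_hull x (B : set 'rV[R]_m.+2) :
  @convex_set R 'rV[R]_m.+2 B -> @first_pyramidal_vectors R m.+2 `<=` B ->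
  ineqs x -> B x.
Proof.
move=> cB VB [h0 hx x0 xi].
have xm : 0 <= x 0 ord_max by have := xi ord_max isT; rewrite eqxx mul0r.
have [r [s [r0 s0 rx sx rs]]] : exists r s,
    [/\ 0 <= r, 0 <= s, r <= x 0 ord0, s <= x 0 ord_max & r + s = height x].
  (* Greedy choice: r is the minimum of the height and x_1, and s is the rest. *)
  have [hle|hge] := leP (height x) (x 0 ord0).
    by exists (height x), 0; split; rewrite ?addr0.
  exists (x 0 ord0), (height x - x 0 ord0); split => //; lra.
have hE : m%:R * height x = \sum_i x 0 i - 1.
  by rewrite mulrC divfK// pnatr_eq0 -lt0n.
pose alpha := @interval_vector R m.+2 1 m.+1.
pose beta := @interval_vector R m.+2 2 m.+2.
(* Left indices carry the unit vectors, which make up what alpha and beta leave of each coordinate;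
   [true] stands for alpha and [false] for beta. *)
pose c (i : 'I_m.+2 + bool) : R := match i with
  | inl i => x 0 i - r * (i != ord_max)%:R - s * (i != ord0)%:R
  | inr b => if b then r else s end.
pose z (i : 'I_m.+2 + bool) : 'rV[R]_m.+2 := match i with
  | inl i => unit_vector i
  | inr b => if b then alpha else beta end.
have -> : x = \sum_i c i *: z i.
  rewrite big_sumType/= big_bool/=; apply/rowP => i.
  rewrite !mxE summxE (bigD1 i)//= big1 => [|j ji]; last first.
    by rewrite !mxE eqxx [_ == j]eq_sym (negPf ji) mulr0.
  by rewrite !mxE !eqxx alphaE betaE mulr1; ring.
apply: convex_set_sum => //.
- case=> [i|[]] //=.
  have [->|i0] := eqVneq i ord0; first by rewrite mulr1 mulr0; lra.
  have [->|im] := eqVneq i ord_max; first by rewrite mulr0 mulr1; lra.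
  by have := xi i i0; rewrite im mul1r !mulr1; lra.
(* With h = r + s the height, the unit vectors have total weight (1 + m h) - (m + 1) h = 1 - h. *)
- rewrite big_sumType/= big_bool/= !big_split/= !sumrN -!mulr_sumr !sum_neq.
  by rewrite -natr1; move: hE; rewrite -rs; lra.
- by case=> [i|[]] /=; apply: VB; [left; exists i|right; left|right; right].
Qed.

Lemma first_pyramidal_polytopeE :
  first_pyramidal_polytope R m.+2 =
  [set x : 'rV[R]_m.+2 | [/\ 0 <= height x, height x <= x 0 ord0 + x 0 ord_max,
    0 <= x 0 ord0 &
    forall i, i != ord0 -> (i != ord_max)%:R * height x <= x 0 i]].
Proof.
apply/seteqP; split => x.
  by apply; split; [exact: convex_ineqs|exact: vectors_ineqs].
by move=> hx B [cB VB]; exact: ineqs_hull.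
Qed.

End PyramidHull.

Theorem theorem5 (R : realType) (n : nat) (n_ge3 : (3 <= n)%N) :
  normalized_volume (first_pyramidal_polytope R n) = (2 * (n%:R - 2))%:E.
Proof.
case: n n_ge3 => [//|[//|m]]; rewrite !ltnS => m0.
rewrite /normalized_volume /euclidean_volume (first_pyramidal_polytopeE m0).
(* Row vectors and tuples with the same entries satisfy the same inequalities. *)
rewrite (_ : mkset _ = @pyramid R m); last first.
  apply/seteqP; split => t /=; set x := (\row_i tnth t i);
    have xE i : x 0 i = tnth t i by [rewrite mxE];
    have hE : height x = level t
      by [rewrite /height /level; under eq_bigr do rewrite xE].
    move=> [h0 hx x0 xi]; apply/(pyramidP _ m0); rewrite -hE -!xE.
    by split => // i i0; rewrite -xE; exact: xi.
  move=> /(pyramidP _ m0)[h0 hx x0 xi]; split; rewrite ?hE ?xE// => i i0.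
  by rewrite xE; exact: xi.
rewrite lebesgue_tuple_pyramid// -EFinM; congr EFin.
rewrite -addn2 natrD addrK mulrCA mulrC; congr (_ * _).
by rewrite mulrC divfK// pnatr_eq0 -lt0n fact_gt0.
Qed.
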